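(* Let $m\ge 0$, $n\ge 2$ and $t$ be integers with $1\le t\le m+n-2$. Then $$\kappa(D_{m,n};K_{1,t})=\kappa^s(D_{m,n};K_{1,t})=\left\lceil\frac{n-1}{1+t}\right\rceil+m .$$
   Context: All graphs are finite and simple. $K_{1,t}$ is the star with one center and $t$ leaves. Structure connectivity. For a set $\mathcal{F}$ of subgraphs of a connected graph $G$ (no disjointness is required), let $V(\mathcal{F})$ be the union of the vertex sets of its members and $G-\mathcal{F}=G-V(\mathcal{F})$. $\mathcal{F}$ is a subgraph cut of $G$ if $G-\mathcal{F}$ is disconnected or is a trivial graph (a single vertex). For a connected graph $H$, an $H$-structure cut (resp. $H$-substructure cut) is a subgraph cut each of whose members is isomorphic to $H$ (resp. to a connected subgraph of $H$). $\kappa(G;H)$ (resp. $\kappa^s(G;H)$) is the minimum cardinality of an $H$-structure cut (resp. $H$-substructure cut) of $G$. DCell. Let $t_{0,n}=n$ and $t_{m,n}=t_{m-1,n}(t_{m-1,n}+1)$ for $m\ge 1$. Let $I_{0,n}=\{0,1,\dots,n-1\}$ and $I_{i,n}=\{0,1,\dots,t_{i-1,n}\}$ for $i\ge 1$. The $m$-dimensional DCell with $n$-port switches, $D_{m,n}$ ($m\ge 0$, $n\ge 2$), is the graph with vertex set $\{x_mx_{m-1}\cdots x_0 : x_i\in I_{i,n}\}$ defined recursively: $D_{0,n}$ is the complete graph on $n$ vertices; for $m\ge 1$, $D_{m,n}$ is obtained from $t_{m-1,n}+1$ disjoint copies $D^i_{m-1,n}$ ($i\in I_{m,n}$) of $D_{m-1,n}$,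 where the labels in the $i$-th copy are prefixed by $i$, by adding the following edges: for $u_m<v_m$ in $I_{m,n}$, the vertex $u=u_mu_{m-1}\cdots u_0$ is adjacent to $v=v_mv_{m-1}\cdots v_0$ if and only if $u_m=v_0+\sum_{j=1}^{m-1}v_j t_{j-1,n}$ and $v_m=u_0+\sum_{j=1}^{m-1}u_jt_{j-1,n}+1$. *)

(* Defs.v *)
From HB Require Import structures.
From mathcomp Require Import all_boot all_order all_algebra.

Set Implicit Arguments.
Unset Strict Implicit.
Unset Printing Implicit Defensive.

Record sgraph := SGraph {
  vertex :> finType;
  adj : rel vertex;
  adj_sym : symmetric adj;
  adj_irrefl : irreflexive adj
}.

Definition edges (G : sgraph) : {set {set G}} :=
  [set [set p.1; p.2] | p : G * G & adj p.1 p.2].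

Definition connected (G : sgraph) : Prop :=
  0 < #|G| /\ forall x y : G, connect (@adj G) x y.

(* A graph without vertices is not disconnected. *)
Definition disconnected (G : sgraph) : Prop :=
  exists x y : G, ~~ connect (@adj G) x y.

Definition trivial_graph (G : sgraph) : Prop := #|G| = 1.

Definition isomorphic (G H : sgraph) : Prop :=
  exists2 f : G -> H, bijective f & forall x y, adj (f x) (f y) = adj x y.

(* A subgraph of G is given by a vertex set and an edge set, not necessarily
   all the edges of G between the chosen vertices. *)
Definition is_subgraph (G : sgraph) (S : {set G} * {set {set G}}) : bool :=
  (S.2 \subset edges G) && [forall e in S.2, e \subset S.1].

Definition subgraph (G : sgraph) : finType :=
  {S : {set G} * {set {set G}} | is_subgraph S}.

Definition sub_vertices (G : sgraph) (S : subgraph G) : {set G} := (val S).1.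
Definition sub_edges (G : sgraph) (S : subgraph G) : {set {set G}} := (val S).2.

Section AsGraph.
Variable G : sgraph.

Definition sub_adj (S : subgraph G) : rel {x : G | x \in sub_vertices S} :=
  fun x y => [set val x; val y] \in sub_edges S.

Lemma sub_adj_sym (S : subgraph G) : symmetric (@sub_adj S).
Proof. by move=> x y; rewrite /sub_adj setUC. Qed.

Lemma sub_adj_irrefl (S : subgraph G) : irreflexive (@sub_adj S).
Proof.
move=> x; apply/negbTE/negP; rewrite /sub_adj /sub_edges => xS.
case/andP: (valP S) => /subsetP/(_ _ xS)/imsetP[[a b] /=].
rewrite inE /= => ab eq_e _; have /set1P a_x : a \in [set val x].
  by move: eq_e; rewrite setUid => ->; rewrite !inE eqxx.
have /set1P b_x : b \in [set val x].
  by move: eq_e; rewrite setUid => ->; rewrite !inE eqxx orbT.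
by move: ab; rewrite a_x b_x adj_irrefl.
Qed.

Definition graph_of_subgraph (S : subgraph G) : sgraph :=
  SGraph (@sub_adj_sym S) (@sub_adj_irrefl S).

Definition induced_adj (A : {set G}) : rel {x : G | x \in A} :=
  fun x y => adj (val x) (val y).

Lemma induced_adj_sym (A : {set G}) : symmetric (@induced_adj A).
Proof. by move=> x y; rewrite /induced_adj adj_sym. Qed.

Lemma induced_adj_irrefl (A : {set G}) : irreflexive (@induced_adj A).
Proof. by move=> x; rewrite /induced_adj adj_irrefl. Qed.

Definition induced (A : {set G}) : sgraph :=
  SGraph (@induced_adj_sym A) (@induced_adj_irrefl A).

Definition remove_subgraphs (F : {set subgraph G}) : sgraph :=
  induced (~: \bigcup_(S in F) sub_vertices S).

Definition subgraph_cut (F : {set subgraph G}) : Prop :=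
  disconnected (remove_subgraphs F) \/ trivial_graph (remove_subgraphs F).

Definition structure_cut (H : sgraph) (F : {set subgraph G}) : Prop :=
  subgraph_cut F /\
  forall S, S \in F -> isomorphic (graph_of_subgraph S) H.

End AsGraph.

Definition substructure_cut (G H : sgraph) (F : {set subgraph G}) : Prop :=
  subgraph_cut F /\
  forall S, S \in F -> exists K : subgraph H,
    connected (graph_of_subgraph K) /\
    isomorphic (graph_of_subgraph S) (graph_of_subgraph K).

Definition is_min_card (T : finType) (P : {set T} -> Prop) (k : nat) : Prop :=
  (exists2 F, P F & #|F| = k) /\ (forall F, P F -> k <= #|F|).

(* kappa(G; H) = k and kappa^s(G; H) = k; both include that a cut exists. *)
Definition structure_connectivity_is (G H : sgraph) (k : nat) : Prop :=
  is_min_card (@structure_cut G H) k.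
Definition substructure_connectivity_is (G H : sgraph) (k : nat) : Prop :=
  is_min_card (@substructure_cut G H) k.

(* K_{1,t}, with center ord0. *)
Definition star_adj (t : nat) : rel 'I_t.+1 :=
  fun x y => (x == ord0) (+) (y == ord0).

Lemma star_adj_sym t : symmetric (@star_adj t).
Proof. by move=> x y; rewrite /star_adj addbC. Qed.

Lemma star_adj_irrefl t : irreflexive (@star_adj t).
Proof. by move=> x; rewrite /star_adj addbb. Qed.

Definition star (t : nat) : sgraph :=
  SGraph (@star_adj_sym t) (@star_adj_irrefl t).

Fixpoint dcell_t (m n : nat) : nat :=
  if m is m'.+1 then dcell_t m' n * (dcell_t m' n).+1 else n.

(* The vertex x_m x_(m-1) ... x_0 is the nested pair (x_m, (x_(m-1), ... x_0)). *)
Fixpoint dcell_vertex (m n : nat) : finType :=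
  if m is m'.+1 then ('I_(dcell_t m' n).+1 * dcell_vertex m' n)%type else 'I_n.

(* The digit x_j, for j <= m (junk otherwise). *)
Fixpoint dcell_digit (m n : nat) : dcell_vertex m n -> nat -> nat :=
  match m return dcell_vertex m n -> nat -> nat with
  | 0 => fun x _ => nat_of_ord x
  | m'.+1 => fun x j =>
      if j == m'.+1 then nat_of_ord x.1 else dcell_digit x.2 j
  end.

(* x_0 + sum_(1 <= j <= m) x_j t_(j-1,n), for x in D_(m,n). *)
Definition dcell_rank (m n : nat) (x : dcell_vertex m n) : nat :=
  dcell_digit x 0 +
  \sum_(1 <= j < m.+1) dcell_digit x j * dcell_t j.-1 n.

(* The edge rule between different copies, for u_m < v_m. *)
Definition dcell_link (m n : nat) (u v : dcell_vertex m.+1 n) : bool :=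
  [&& u.1 < v.1, u.1 == dcell_rank v.2 :> nat
    & v.1 == (dcell_rank u.2).+1 :> nat].

Fixpoint dcell_adj (m n : nat) : rel (dcell_vertex m n) :=
  match m return rel (dcell_vertex m n) with
  | 0 => fun u v => u != v
  | m'.+1 => fun u v =>
      if u.1 == v.1 then dcell_adj u.2 v.2
      else dcell_link u v || dcell_link v u
  end.

Lemma dcell_adj_sym m n : symmetric (@dcell_adj m n).
Proof.
elim: m => [|m IHm] u v /=; first by rewrite eq_sym.
by rewrite eq_sym IHm orbC.
Qed.

Lemma dcell_adj_irrefl m n : irreflexive (@dcell_adj m n).
Proof. by elim: m => [|m IHm] u /=; rewrite eqxx // IHm. Qed.

Definition dcell (m n : nat) : sgraph :=
  SGraph (@dcell_adj_sym m n) (@dcell_adj_irrefl m n).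

(* absz loses nothing here: the ceiling of a / b is nonnegative. *)
Definition ceil_div (a b : nat) : nat :=
  `|Num.ceil ((a%:R / b%:R)%R : rat)|%N.

(* Main.v *)
Require Import Defs.
From mathcomp Require Import all_boot all_order all_algebra.
From mathcomp Require Import zify.

(** Upper bound. Deleting all neighbours of a vertex [x] but not [x] itself
    isolates [x]. The neighbours of [x] consist of a clique of [n - 1]
    vertices and of [m] further vertices, one for each dimension
    ([neighbourhood_blocks]). The clique splits into
    [ceil ((n - 1) / (1 + t))] blocks of at most [1 + t] vertices, each of the
    [m] others is a block, and since all degrees are [m + n - 1 >= t + 1] a
    block grows to a copy of K_(1,t) that avoids [x] ([block_star]).

    Lower bound. A connected subgraph of K_(1,t) is a star with some hub, so
    the claim is that [k < ceil ((n - 1) / (1 + t)) + m] stars with at most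
    [s = 1 + t] vertices never disconnect the graph
    ([star_removal_connected]). The condition is written
    [(k - m) * s < n - 1] with truncated subtraction, which makes it pass
    from ([m], [k]) to ([m - 1], [k - 1]) and allows an induction on [m] in
    which [s] stays fixed.

    The graph of dimension [m + 1] is made of [N + 1] copies of the graph of
    dimension [m], which has [N] vertices; the edges between copies form a
    perfect matching with exactly one edge between any two copies
    ([dcell_adj_cross]). Hence a star lies in the copy of its hub except for
    at most one vertex, the partner of the hub.

    - Consider two copies without hubs. A vertex deleted in one of them has
      a hub as partner, so the edge between these copies survives
      ([live_link]).
    - In a copy met by every star, the partner of a surviving vertex lies in
      a copy met by no star: a star meeting both copies would contain the
      edge between them ([untouched_neighbour]).
    - A copy missed by some star is met by at most [k - 1] stars, so what
      remains of it is connected by induction. If it contains a hub, the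
      stars with hubs in it are at most [k - 1] and, by counting, cannot
      destroy all its edges to the copies without hubs ([live_exit]).

    So every survivor is connected to the family of copies without hubs that
    some star misses, and these are connected to each other. *)

Set Implicit Arguments.
Unset Strict Implicit.
Unset Printing Implicit Defensive.

(** * Stars and connectivity after deleting a vertex set *)

Definition is_hub (T : finType) (e : rel T) (S : {set T}) (c : T) : bool :=
  (c \in S) && [forall v in S, (v == c) || e c v].

(** Trace of a star as a mere vertex set: this is all that matters once the
    vertices are deleted, and it is stable under intersection with a copy. *)
Definition star_like (T : finType) (e : rel T) (S : {set T}) : bool :=
  [exists c, is_hub e S c].

(** Connectivity after deleting [X] is expressed on the whole vertex type, so
    that walks in different copies concatenate without transporting subtypes;
    [connect_induced] translates back. *)
Definition avoid (T : finType) (e : rel T) (X : {set T}) : rel T :=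
  [rel u v | [&& u \notin X, v \notin X & e u v]].

Lemma is_hub_mem (T : finType) (e : rel T) (S : {set T}) (c : T) :
  is_hub e S c -> c \in S.
Proof. by case/andP. Qed.

Lemma is_hub_adj (T : finType) (e : rel T) (S : {set T}) (c v : T) :
  is_hub e S c -> v \in S -> v != c -> e c v.
Proof.
by case/andP=> _ /forallP/(_ v)/implyP h vS; move: (h vS); case: eqP.
Qed.

Lemma connect_homo (T U : finType) (e : rel T) (e' : rel U) (f : T -> U) :
  (forall x y, e x y -> e' (f x) (f y)) ->
  forall x y, connect e x y -> connect e' (f x) (f y).
Proof.
move=> fe x y /connectP[p ep ->]; apply/connectP; exists (map f p).
  exact: homo_path ep.
by rewrite last_map.
Qed.

(** * Crossing edges between the copies *)

Lemma dcell_rankS m n (u : dcell_vertex m.+1 n) :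
  dcell_rank u = u.1 * dcell_t m n + dcell_rank u.2.
Proof.
rewrite /dcell_rank big_nat_recr //= eqxx addnA addnC; congr (_ + (_ + _)).
by apply: eq_big_nat => j /andP[_ jm]; rewrite ifN // neq_ltn jm.
Qed.

Lemma dcell_rank_lt m n (x : dcell_vertex m n) : dcell_rank x < dcell_t m n.
Proof.
elim: m x => [|m IHm] x.
  by rewrite /dcell_rank big_geq // addn0 /= ltn_ord.
rewrite dcell_rankS /= mulnSr -addnS.
by apply: leq_add; [rewrite leq_mul2r -ltnS ltn_ord orbT | exact: IHm].
Qed.

Lemma dcell_rank_inj m n : injective (@dcell_rank m n).
Proof.
elim: m => [|m IHm] x y.
  by rewrite /dcell_rank !big_geq // !addn0 => /val_inj.
rewrite !dcell_rankS => eq_xy.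
have xl := dcell_rank_lt x.2; have yl := dcell_rank_lt y.2.
have e1 : x.1 = y.1 :> nat by nia.
have e2 : x.2 = y.2 by apply: IHm; move: eq_xy; rewrite e1; lia.
by case: x y e1 e2 {eq_xy xl yl} => [a b] [c d] /= /val_inj -> ->.
Qed.

Lemma card_dcell m n : #|dcell_vertex m n| = dcell_t m n.
Proof.
by elim: m => [|m IHm] /=; rewrite ?card_prod card_ord // IHm mulnC.
Qed.

(** The rank numbers the vertices of a copy bijectively, and the link rule
    reads: the vertex of port [r] in copy [i] goes to the [r]-th copy other
    than [i], that is to copy [lift i r]. *)
Definition dcell_port m n (x : dcell_vertex m n) : 'I_(dcell_t m n) :=
  Ordinal (dcell_rank_lt x).

Lemma dcell_port_inj m n : injective (@dcell_port m n).
Proof. by move=> x y /(congr1 val)/dcell_rank_inj. Qed.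

Lemma dcell_port_surj m n (r : 'I_(dcell_t m n)) :
  exists x : dcell_vertex m n, dcell_port x = r.
Proof.
have := @inj_card_bij _ _ _ (@dcell_port_inj m n).
by rewrite card_ord card_dcell => /(_ (leqnn _)) [g _ gK]; exists (g r).
Qed.

Definition in_copy m n (i : 'I_(dcell_t m n).+1) (x : dcell_vertex m n) :
  dcell_vertex m.+1 n := (i, x).

Lemma in_copyE m n (u : dcell_vertex m.+1 n) : u = in_copy u.1 u.2.
Proof. by case: u. Qed.

Lemma in_copy_inj m n i : injective (@in_copy m n i).
Proof. by move=> x y []. Qed.

Lemma dcell_adj_in m n i (x y : dcell_vertex m n) :
  dcell_adj (in_copy i x) (in_copy i y) = dcell_adj x y.
Proof. by rewrite /= eqxx. Qed.

(** The two cases of the asymmetric edge rule, [u_m < v_m] and [v_m < u_m],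
    are absorbed by the shift built into [lift]. This symmetric form shows
    that the crossing edges form a perfect matching, with exactly one edge
    between any two copies; the next lemmas are its consequences. *)
Lemma dcell_adj_cross m n i j (x y : dcell_vertex m n) : i != j ->
  dcell_adj (in_copy i x) (in_copy j y) =
  (j == lift i (dcell_port x)) && (i == lift j (dcell_port y)).
Proof.
move=> ij; rewrite /= (negPf ij) /dcell_link /=.
rewrite -!(inj_eq val_inj) /= /bump.
move: ij; rewrite -(inj_eq val_inj) /=; lia.
Qed.

Lemma cross_exists m n i j : i != j ->
  exists x y : dcell_vertex m n, dcell_adj (in_copy i x) (in_copy j y).
Proof.
move=> ij; have ji : j != i by rewrite eq_sym.
have [r rE _] := unlift_some ij; have [r' rE' _] := unlift_some ji.
have [x xE] := dcell_port_surj r; have [y yE] := dcell_port_surj r'.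
by exists x, y; rewrite dcell_adj_cross // xE yE -rE -rE' !eqxx.
Qed.

Lemma cross_neighbour m n i (x : dcell_vertex m n) :
  exists2 j, i != j & exists y, dcell_adj (in_copy i x) (in_copy j y).
Proof.
set j := lift i (dcell_port x); have ij : i != j by exact: neq_lift.
exists j => //; have [x' [y a]] := cross_exists ij.
exists y; suff -> : x = x' by [].
move: a; rewrite dcell_adj_cross // => /andP[/eqP/lift_inj/dcell_port_inj h _].
by [].
Qed.

Lemma cross_copy_uniq m n i j j' (x y y' : dcell_vertex m n) :
  i != j -> i != j' -> dcell_adj (in_copy i x) (in_copy j y) ->
  dcell_adj (in_copy i x) (in_copy j' y') -> j = j'.
Proof.
move=> ij ij'; rewrite !dcell_adj_cross //.
by case/andP=> /eqP -> _ /andP[/eqP -> _].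
Qed.

Lemma cross_uniq m n i j (x x' y y' : dcell_vertex m n) :
  i != j -> dcell_adj (in_copy i x) (in_copy j y) ->
  dcell_adj (in_copy i x') (in_copy j y') -> x = x' /\ y = y'.
Proof.
move=> ij; rewrite !dcell_adj_cross // => /andP[/eqP jE /eqP iE] /andP[jE' iE'].
split; apply: dcell_port_inj.
  by apply: (@lift_inj _ i); rewrite -jE -(eqP jE').
by apply: (@lift_inj _ j); rewrite -iE -(eqP iE').
Qed.

(** * Neighbourhoods *)

Lemma neighbours_in_copy m n i j (x y : dcell_vertex m n) :
  i != j -> dcell_adj (in_copy i x) (in_copy j y) ->
  [set w | dcell_adj (in_copy i x) w] =
    in_copy j y |: (in_copy i @: [set w | dcell_adj x w]).
Proof.
move=> ij a; apply/setP=> w; rewrite [w]in_copyE !inE.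
move: w.1 w.2 => k v {w}; case: (eqVneq i k) => [<-|iw].
  rewrite dcell_adj_in mem_imset ?inE; last exact: in_copy_inj.
  by case: eqP => //= -[jE _]; rewrite jE eqxx in ij.
have -> : (in_copy k v \in in_copy i @: [set w | dcell_adj x w]) = false.
  by apply/negP=> /imsetP[w _ [e _]]; rewrite e eqxx in iw.
rewrite orbF; apply/idP/eqP => [b|[-> ->] //].
have e := cross_copy_uniq ij iw a b; rewrite -e in b *.
by have [_ ->] := cross_uniq ij a b.
Qed.

Lemma card_neighbours m n (x : dcell_vertex m n) : 0 < n ->
  #|[set y | dcell_adj x y]| = m + n - 1.
Proof.
move=> n0; elim: m x => [|m IHm] x.
  rewrite add0n -[in RHS](card_ord n) subn1 -(cardsC1 x).
  by apply: eq_card => y; rewrite !inE eq_sym.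
rewrite [x]in_copyE; move: x.1 x.2 => i z {x}.
have [j ij [y a]] := cross_neighbour i z.
rewrite (neighbours_in_copy ij a) cardsU1 card_imset ?IHm;
  last exact: in_copy_inj.
case: imsetP => [[v _ [e _]]|_]; first by rewrite e eqxx in ij.
by rewrite /=; lia.
Qed.

Lemma star_like_card m n (S : {set dcell_vertex m n}) : 0 < n ->
  star_like (@dcell_adj m n) S -> #|S| <= m + n.
Proof.
move=> n0 /existsP[c hc].
have /subset_leq_card : S \subset c |: [set v | dcell_adj c v].
  apply/subsetP=> v vS; rewrite !inE.
  by case: eqVneq => //= /(is_hub_adj hc vS).
rewrite cardsU1 card_neighbours // => /leq_trans; apply.
by case: (_ \notin _); lia.
Qed.

(** * Traces of a star in the copies *)

(** The lemmas of this part rest on the same remark: a star leaves the copy of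
    its hub by at most one vertex, through the crossing edge at the hub. *)
Lemma hub_cross m n i j (S : {set dcell_vertex m.+1 n})
    (x y z : dcell_vertex m n) :
  i != j -> dcell_adj (in_copy i x) (in_copy j y) ->
  is_hub (@dcell_adj m.+1 n) S (in_copy i z) -> in_copy j y \in S -> z = x.
Proof.
move=> ij a h yS; have b : dcell_adj (in_copy i z) (in_copy j y).
  by apply: is_hub_adj h yS _; apply: contra_neq ij => -[].
by have [-> _] := cross_uniq ij b a.
Qed.

Lemma hub_copy m n i j (S : {set dcell_vertex m.+1 n}) c
    (x y : dcell_vertex m n) :
  i != j -> dcell_adj (in_copy i x) (in_copy j y) ->
  is_hub (@dcell_adj m.+1 n) S c -> in_copy i x \in S -> c.1 != i -> c.1 = j.
Proof.
rewrite [c]in_copyE; move: c.1 c.2 => k z {c} /= ij a h xS ki.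
have b : dcell_adj (in_copy k z) (in_copy i x).
  by apply: is_hub_adj h xS _; apply: contra_neq ki => -[].
rewrite dcell_adj_sym in b; rewrite eq_sym in ki.
exact: cross_copy_uniq ki ij b a.
Qed.

Definition slice m n (a : 'I_(dcell_t m n).+1) (S : {set dcell_vertex m.+1 n}) :
  {set dcell_vertex m n} := [set x | in_copy a x \in S].

(** A star which meets two copies can only do so through the single edge
    between them, hence it contains both ends of that edge. *)
Lemma star_two_copies m n i j (S : {set dcell_vertex m.+1 n})
    (x y : dcell_vertex m n) :
  i != j -> dcell_adj (in_copy i x) (in_copy j y) ->
  star_like (@dcell_adj m.+1 n) S ->
  slice i S != set0 -> slice j S != set0 -> in_copy i x \in S.
Proof.
move=> ij a /existsP[c h] /set0Pn[u]; rewrite inE => uS /set0Pn[v].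
rewrite inE => vS; move: h; rewrite [c]in_copyE; move: c.1 c.2 => k z {c} h.
case: (eqVneq k i) => [ki|ki].
  move: h; rewrite {}ki => h; have zS := is_hub_mem h.
  suff <- : z = x by [].
  have b : dcell_adj (in_copy i z) (in_copy j v).
    by apply: is_hub_adj h vS _; apply: contra_neq ij => -[].
  by have [-> _] := cross_uniq ij b a.
have b : dcell_adj (in_copy k z) (in_copy i u).
  by apply: is_hub_adj h uS _; apply: contra_neq ki => -[].
case: (eqVneq k j) => [kj|kj].
  move: h b; rewrite {}kj => h b; rewrite dcell_adj_sym in b.
  by have [<- _] := cross_uniq ij b a.
have d : dcell_adj (in_copy k z) (in_copy j v).
  by apply: is_hub_adj h vS _; apply: contra_neq kj => -[].
by have e := cross_copy_uniq ki kj b d; rewrite e eqxx in ij.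
Qed.

(** If the hub lies in copy [a] it remains a hub; otherwise the slice is a
    single vertex, the partner of the hub. *)
Lemma slice_star_like m n a (S : {set dcell_vertex m.+1 n}) :
  star_like (@dcell_adj m.+1 n) S -> slice a S != set0 ->
  star_like (@dcell_adj m n) (slice a S).
Proof.
case/existsP=> c; rewrite [c]in_copyE; move: c.1 c.2 => k z {c} h.
case/set0Pn=> u uS; apply/existsP; case: (eqVneq k a) => [ka|ka].
  exists z; move: h; rewrite ka => h.
  apply/andP; split; first by rewrite inE (is_hub_mem h).
  apply/forall_inP => v; rewrite inE => vS; case: eqVneq => //= vz.
  rewrite -(dcell_adj_in a); apply: is_hub_adj h vS _.
  by apply: contra_neq vz => /in_copy_inj.
exists u; apply/andP; split=> //; apply/forall_inP => v vS.
have l w : w \in slice a S -> dcell_adj (in_copy k z) (in_copy a w).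
  by rewrite inE => wS; apply: is_hub_adj h wS _; apply: contra_neq ka => -[].
by have [_ ->] := cross_uniq ka (l u uS) (l v vS); rewrite eqxx.
Qed.

Lemma card_slice m n a (S : {set dcell_vertex m.+1 n}) : #|slice a S| <= #|S|.
Proof.
rewrite -(card_imset _ (@in_copy_inj m n a)); apply: subset_leq_card.
by apply/subsetP=> _ /imsetP[x + ->]; rewrite inE.
Qed.

(** The stars meeting copy [a] are kept apart from their slices: distinct
    stars may have the same slice, and only the former can be compared with
    [F]. *)
Definition touching m n a (F : {set {set dcell_vertex m.+1 n}}) :=
  [set S in F | slice a S != set0].

Definition slices m n a (F : {set {set dcell_vertex m.+1 n}}) :=
  slice a @: touching a F.

Lemma cover_slices m n a (F : {set {set dcell_vertex m.+1 n}}) x :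
  (x \in cover (slices a F)) = (in_copy a x \in cover F).
Proof.
apply/bigcupP/bigcupP => [[_ /imsetP[S + ->]]|[S SF xS]].
  by rewrite !inE => /andP[SF _] xS; exists S.
exists (slice a S); last by rewrite inE.
apply/imsetP; exists S => //; rewrite inE SF; apply/set0Pn.
by exists x; rewrite inE.
Qed.

(** * Counting the room left by few stars *)

Lemma dcell_t_ge m n : 0 < n -> m + n <= dcell_t m n.
Proof.
move=> n0; elim: m => //= m IHm.
have T0 : 0 < dcell_t m n by lia.
by apply: leq_trans (leq_pmull _ T0); rewrite addSn.
Qed.

(** When [k <= m] the cap [m + n] on the size of a star is used, as [s] is
    then unconstrained; when [k > m] the hypothesis forces [s <= n - 2]. In
    both cases the bound [(m + n - 1) * (m + n) <= dcell_t m n], valid for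
    positive [m], leaves room. *)
Lemma few_stars_lt_dcell m n k s : (k - m) * s < n - 1 ->
  k * minn s (m + n) + 1 < dcell_t m n.
Proof.
move=> h; case: m h => [|m] h; rewrite ?add0n [dcell_t _ _]/=.
  have le_min : k * minn s n <= k * s by rewrite leq_mul2l geq_minl orbT.
  by move: le_min h; rewrite subn0; move: (k * minn s _) (k * s); lia.
have n0 : 0 < n by move: h; move: ((k - m.+1) * s); lia.
have tm : m + n <= dcell_t m n by exact: dcell_t_ge.
have big : (m + n) * (m + n).+1 <= dcell_t m n * (dcell_t m n).+1.
  by apply: leq_mul.
apply: leq_trans big.
case: (leqP k m.+1) => km.
  have le_cap : k * minn s (m.+1 + n) <= m.+1 * (m.+1 + n).
    by apply: leq_mul => //; apply: geq_minr.
  by move: le_cap h; move: (k * minn s _) ((k - m.+1) * s); nia.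
have sn : s <= n - 2.
  have : s <= (k - m.+1) * s by rewrite leq_pmull // subn_gt0.
  by move: h; move: ((k - m.+1) * s); lia.
have le_min : k * minn s (m.+1 + n) <= k * s by rewrite leq_mul2l geq_minl orbT.
have ks : k * s = (k - m.+1) * s + m.+1 * s by rewrite -mulnDl subnK // ltnW.
have le_s : m.+1 * s <= m.+1 * (n - 2) by rewrite leq_mul2l sn orbT.
move: ks le_min le_s h.
by move: (k * minn s _) (k * s) ((k - _) * s) (m.+1 * s); nia.
Qed.

(** Here [ka] stars have their hub in a given copy of dimension [m]: the left
    side bounds the crossing edges they destroy, plus the number of other
    copies that contain a hub. The worst case is [ka = k - 1], which is the
    previous bound for [k - 1] stars. *)
Lemma few_stars_lt_copies m n s k ka : 0 < s ->
  (k - m.+1) * s < n - 1 -> 0 < ka < k ->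
  ka * minn s (m + n) + (k - ka) < dcell_t m n.
Proof.
move=> s0 h /andP[a0 ak].
have n0 : 0 < n by move: h; move: ((k - m.+1) * s); lia.
have c0 : 0 < minn s (m + n) by rewrite leq_min s0; lia.
have := @few_stars_lt_dcell m n k.-1 s.
have -> : k.-1 - m = k - m.+1 by lia.
move=> /(_ h); apply: leq_ltn_trans.
by move: (minn s _) c0; nia.
Qed.

Lemma avoid_sym m n (X : {set dcell_vertex m n}) :
  connect_sym (avoid (@dcell_adj m n) X).
Proof.
apply: sym_connect_sym => u v; rewrite /avoid /= andbCA.
by have -> : dcell_adj u v = dcell_adj v u by exact: dcell_adj_sym.
Qed.

Lemma card_bigcup_leq (I T : finType) (P : {set I}) (A : I -> {set T}) c :
  (forall i, i \in P -> #|A i| <= c) -> #|\bigcup_(i in P) A i| <= #|P| * c.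
Proof.
move=> Ac; rewrite -sum_nat_const.
elim/big_ind2: _ => [|B k C l Bk Cl|i /Ac //]; first by rewrite cards0.
by apply: leq_trans (leq_add Bk Cl); rewrite cardsU leq_subr.
Qed.

(** * Few stars do not disconnect *)

(** A choice of hubs: a star with two vertices has two possible ones, and the
    counting argument needs at most one hub copy for each star. *)
Definition hubs_of m n (F : {set {set dcell_vertex m n}})
    (h : {set dcell_vertex m n} -> dcell_vertex m n) :=
  forall S, S \in F -> is_hub (@dcell_adj m n) S (h S).

Lemma hubs_exist m n (F : {set {set dcell_vertex m n}}) :
  dcell_vertex m n -> (forall S, S \in F -> star_like (@dcell_adj m n) S) ->
  exists h, hubs_of F h.
Proof.
move=> x0 st; exists (fun S => odflt x0 [pick c | is_hub (@dcell_adj m n) S c]).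
move=> S /st /existsP[c hc]; case: pickP => //= /(_ c).
by rewrite hc.
Qed.

Definition hub_copies m n (F : {set {set dcell_vertex m.+1 n}})
    (h : {set dcell_vertex m.+1 n} -> dcell_vertex m.+1 n) :
  {set 'I_(dcell_t m n).+1} := [set (h S).1 | S in F].

(** A vertex deleted in a copy without hub is the partner of a hub, so its
    partner is deleted too. *)
Lemma live_end m n (F : {set {set dcell_vertex m.+1 n}}) h i b
    (x y : dcell_vertex m n) :
  hubs_of F h -> b \notin hub_copies F h -> i != b ->
  dcell_adj (in_copy i x) (in_copy b y) ->
  in_copy i x \notin cover F -> in_copy b y \notin cover F.
Proof.
move=> hF bC ib a; apply: contra => /bigcupP[S SF yS]; apply/bigcupP.
exists S => //; have hS := hF _ SF.
have hb : (h S).1 != b by apply: contraNneq bC => <-; apply: imset_f.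
have a' := a; rewrite dcell_adj_sym in a'; rewrite eq_sym in ib.
have hi : (h S).1 = i by apply: hub_copy ib a' hS yS hb.
rewrite eq_sym in ib.
have hE : h S = in_copy i (h S).2 by rewrite -hi -in_copyE.
rewrite hE in hS; have e := hub_cross ib a hS yS.
by rewrite e in hS; exact: is_hub_mem hS.
Qed.

(** Deleting an end of this edge in a copy without hub would put a hub at the
    other end. *)
Lemma live_link m n (F : {set {set dcell_vertex m.+1 n}}) h b b'
    (x y : dcell_vertex m n) :
  hubs_of F h -> b \notin hub_copies F h -> b' \notin hub_copies F h ->
  b != b' -> dcell_adj (in_copy b x) (in_copy b' y) ->
  in_copy b x \notin cover F.
Proof.
move=> hF bC b'C bb' a; apply/negP => /bigcupP[S SF xS].
have hS := hF _ SF.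
have hb : (h S).1 != b by apply: contraNneq bC => <-; apply: imset_f.
have e := hub_copy bb' a hS xS hb.
by case/negP: b'C; rewrite -e; apply: imset_f.
Qed.

(** A star meeting both [a] and [b] would contain the whole edge between them
    by [star_two_copies], whereas its end in [a] survives. *)
Lemma untouched_neighbour m n (F : {set {set dcell_vertex m.+1 n}}) a b
    (x y : dcell_vertex m n) :
  (forall S, S \in F -> star_like (@dcell_adj m.+1 n) S) ->
  touching a F = F -> a != b -> dcell_adj (in_copy a x) (in_copy b y) ->
  in_copy a x \notin cover F -> touching b F = set0.
Proof.
move=> st aF ab adj_ab xF; apply/setP=> S; rewrite !inE.
apply/negP=> /andP[SF Sb]; case/negP: xF; apply/bigcupP; exists S => //.
have := SF; rewrite -{1}aF inE => /andP[_ Sa].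
exact: star_two_copies ab adj_ab (st _ SF) Sa Sb.
Qed.

(** Otherwise, for every copy [b] without hub, the end in [a] of the edge
    towards [b] is deleted, necessarily by a star whose hub is in [a]. Sending
    a deleted vertex of [a] to the copy of its partner then covers all
    hub-free copies, which is too many for these stars. *)
Lemma live_exit m n s (F : {set {set dcell_vertex m.+1 n}}) h a :
  0 < s -> hubs_of F h -> (forall S, S \in F -> #|S| <= s) ->
  (#|F| - m.+1) * s < n - 1 ->
  a \in hub_copies F h -> #|touching a F| < #|F| ->
  exists x b y, [/\ b \notin hub_copies F h, a != b,
    dcell_adj (in_copy a x) (in_copy b y) & in_copy a x \notin cover F].
Proof.
move=> s0 hF sF Fs aC tF.
have n0 : 0 < n by move: Fs; move: ((#|F| - m.+1) * s); lia.
pose Fa := [set S in F | (h S).1 == a].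
have FaF : #|Fa| < #|F|.
  apply: leq_ltn_trans tF; apply: subset_leq_card; apply/subsetP => S.
  rewrite !inE => /andP[SF /eqP ha]; rewrite SF; apply/set0Pn.
  by exists (h S).2; rewrite inE -ha -in_copyE; apply: is_hub_mem (hF _ SF).
have Fa0 : 0 < #|Fa|.
  case/imsetP: aC => S SF aE; apply/card_gt0P; exists S.
  by rewrite inE SF aE eqxx.
have C_le : #|hub_copies F h| <= (#|F| - #|Fa|).+1.
  have /subset_leq_card : hub_copies F h \subset
      a |: [set (h S).1 | S in F :\: Fa].
    apply/subsetP=> _ /imsetP[S SF ->]; rewrite in_setU1.
    case: eqVneq => //= ha; apply: imset_f; rewrite !inE SF andbT.
    by rewrite negb_and ha orbT.
  move=> /leq_trans; apply; rewrite cardsU1.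
  have -> : #|F| - #|Fa| = #|F :\: Fa|.
    by rewrite cardsDS //; apply/subsetP => S; rewrite inE => /andP[].
  by apply: (@leq_add _ _ 1); [exact: leq_b1 | exact: leq_imset_card].
pose X := \bigcup_(S in Fa) slice a S.
have X_le : #|X| <= #|Fa| * minn s (m + n).
  apply: card_bigcup_leq => S; rewrite inE => /andP[SF /eqP ha].
  rewrite leq_min (leq_trans (card_slice a S) (sF _ SF)) /=.
  have st : star_like (@dcell_adj m.+1 n) S by apply/existsP; exists (h S);
    apply: hF.
  apply: star_like_card n0 (slice_star_like st _); apply/set0Pn.
  by exists (h S).2; rewrite inE -ha -in_copyE; apply: is_hub_mem (hF _ SF).
pose D := [set lift a (dcell_port x) | x in X].
have : ~~ (~: hub_copies F h \subset D).
  apply/negP=> /subset_leq_card CD.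
  have := @few_stars_lt_copies m n s #|F| #|Fa| s0 Fs;
    rewrite Fa0 FaF => /(_ isT).
  have D_le := leq_trans CD (leq_trans (leq_imset_card _ _) X_le).
  have := leq_add C_le D_le; rewrite cardsC card_ord addSn ltnS addnC => N_le.
  by rewrite ltnNge N_le.
case/subsetPn=> b; rewrite inE => bC bD.
have ab : a != b by apply: contraNneq bC => <-.
have [x [y adj_ab]] := cross_exists ab; exists x, b, y; split=> //.
apply/negP=> /bigcupP[S SF xS]; have hS := hF _ SF.
have ha : (h S).1 = a.
  apply: contraNeq bC => ha; rewrite -(hub_copy ab adj_ab hS xS ha).
  by apply: imset_f.
case/negP: bD; apply/imsetP; exists x.
  by apply/bigcupP; exists S; rewrite inE ?SF ?xS // ha eqxx.
by move: adj_ab; rewrite dcell_adj_cross // => /andP[/eqP].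
Qed.

(** Induction on the dimension. Call a copy good if it contains no hub and is
    missed by some star (or no star is present): good copies stay connected by
    induction and are joined pairwise by surviving edges, so it is enough to
    lead every survivor to a good copy. In a copy met by all stars, the
    survivor steps directly to an untouched copy ([untouched_neighbour]). In
    any other copy containing a hub, induction connects the survivors to an
    exit towards a hub-free copy ([live_exit]). *)
Lemma star_removal_connected m n s (F : {set {set dcell_vertex m n}}) :
  0 < s -> (forall S, S \in F -> star_like (@dcell_adj m n) S) ->
  (forall S, S \in F -> #|S| <= s) -> (#|F| - m) * s < n - 1 ->
  forall x y, x \notin cover F -> y \notin cover F ->
  connect (avoid (@dcell_adj m n) (cover F)) x y.
Proof.
move=> s0; elim: m F => [|m IHm] F st sF Fs x y xF yF.
  (* deleting vertices of a complete graph leaves a complete graph *)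
  case: (eqVneq x y) => [->//|xy]; apply: connect1.
  by rewrite /avoid /= xF yF.
have [h hF] := hubs_exist x st.
(* The predecessor makes every copy light when [F] is empty, so that this case
   is settled by induction like the others. *)
pose light b := #|touching b F| <= #|F|.-1.
have IH b u v : light b -> in_copy b u \notin cover F ->
    in_copy b v \notin cover F ->
    connect (avoid (@dcell_adj m.+1 n) (cover F)) (in_copy b u) (in_copy b v).
  move=> lb uF vF.
  apply: (@connect_homo _ _ (avoid (@dcell_adj m n) (cover (slices b F)))).
    by move=> w z; rewrite /avoid /= !cover_slices eqxx.
  apply: IHm; rewrite ?cover_slices //.
  - move=> _ /imsetP[S + ->]; rewrite inE => /andP[SF Sb].
    by apply: slice_star_like Sb; apply: st.
  - move=> _ /imsetP[S + ->]; rewrite inE => /andP[SF _].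
    by apply: leq_trans (card_slice _ _) (sF _ SF).
  apply: leq_ltn_trans Fs; rewrite leq_mul2r; apply/orP; right.
  rewrite subnS predn_sub leq_sub2r //.
  exact: leq_trans (leq_imset_card _ _) lb.
pose good b := (b \notin hub_copies F h) && light b.
have good_good b b' u v : good b -> good b' -> in_copy b u \notin cover F ->
    in_copy b' v \notin cover F ->
    connect (avoid (@dcell_adj m.+1 n) (cover F)) (in_copy b u) (in_copy b' v).
  move=> /andP[bC lb] /andP[b'C lb'] uF vF.
  case: (eqVneq b b') => [e|bb']; first by rewrite -{b' b'C lb'}e in vF *;
    apply: IH.
  have [w [z a]] := cross_exists bb'.
  have wF := live_link hF bC b'C bb' a.
  have zF := live_end hF b'C bb' a wF.
  apply: connect_trans (IH _ _ _ lb uF wF) _.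
  apply: connect_trans (IH _ _ _ lb' zF vF); apply: connect1.
  by rewrite /avoid /= wF zF.
have heavy_good a u : ~~ light a -> in_copy a u \notin cover F ->
    exists b v, [/\ good b, in_copy b v \notin cover F &
      connect (avoid (@dcell_adj m.+1 n) (cover F)) (in_copy a u)
        (in_copy b v)].
  rewrite /light -ltnNge => la uF.
  have aF : touching a F = F.
    apply/eqP; rewrite eqEcard; apply/andP; split.
      by apply/subsetP=> S; rewrite inE => /andP[].
    by move: la; lia.
  have [b ab [v e]] := cross_neighbour a u.
  have b0 := untouched_neighbour st aF ab e uF.
  have bC : b \notin hub_copies F h.
    apply/negP => /imsetP[S SF bE].
    suff : S \in touching b F by rewrite b0 inE.
    rewrite inE SF; apply/set0Pn; exists (h S).2.
    by rewrite inE bE -in_copyE; apply: is_hub_mem (hF _ SF).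
  have vF := live_end hF bC ab e uF.
  exists b, v; split=> //; first by rewrite /good bC /light b0 cards0.
  by apply: connect1; rewrite /avoid /= uF vF.
have to_good a u : in_copy a u \notin cover F ->
    exists b v, [/\ good b, in_copy b v \notin cover F &
      connect (avoid (@dcell_adj m.+1 n) (cover F)) (in_copy a u)
        (in_copy b v)].
  move=> uF; case: (boolP (light a)) => [la|]; last by move/heavy_good; apply.
  case: (boolP (a \in hub_copies F h)) => aC; last first.
    by exists a, u; split=> //; rewrite /good aC.
  have aF : #|touching a F| < #|F|.
    case/imsetP: aC => S SF _; have : 0 < #|F| by apply/card_gt0P; exists S.
    by move: la; rewrite /light; lia.
  have [w [b [v [bC ab e wF]]]] := live_exit s0 hF sF Fs aC aF.
  have vF := live_end hF bC ab e wF.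
  have uv : connect (avoid (@dcell_adj m.+1 n) (cover F)) (in_copy a u)
    (in_copy b v).
    apply: connect_trans (IH _ _ _ la uF wF) _.
    by apply: connect1; rewrite /avoid /= wF vF.
  case: (boolP (light b)) => [lb|/heavy_good]; first by exists b, v;
    rewrite /good bC.
  move=> /(_ _ vF) [b' [v' [gb' v'F vv']]]; exists b', v'; split=> //.
  exact: connect_trans uv vv'.
rewrite [x]in_copyE in xF *; rewrite [y]in_copyE in yF *.
have [b [u [gb uF xu]]] := to_good _ _ xF.
have [b' [v [gb' vF yv]]] := to_good _ _ yF.
apply: connect_trans xu (connect_trans (good_good _ _ _ _ gb gb' uF vF) _).
by rewrite avoid_sym.
Qed.

(** * The lower bound for substructure cuts *)

(** The adjunction that characterises the ceiling, and the only form in which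
    it is used. *)
Lemma ltn_ceil_div k a b : 0 < b -> (k < ceil_div a b) = (k * b < a).
Proof.
move=> b0; rewrite /ceil_div.
set x := (a%:R / b%:R)%R : rat.
have x0 : (0 <= Num.ceil x)%R.
  rewrite -[0%R](@Num.Theory.ceil0 rat).
  by apply: Num.Theory.ceil_le; rewrite Num.Theory.divr_ge0 ?Num.Theory.ler0n.
rewrite -ltz_nat gez0_abs //
  Num.Theory.real_ceil_gt_int ?Num.Theory.num_real //.
rewrite /x Num.Theory.ltr_pdivlMr ?Num.Theory.ltr0n //.
by rewrite -[(_%:~R)%R]/(k%:R)%R -GRing.natrM Num.Theory.ltr_nat.
Qed.

Lemma mem_edges (G : sgraph) (x y : G) : ([set x; y] \in edges G) = adj x y.
Proof.
apply/imsetP/idP => [[[a b]]|xy]; last by exists (x, y); rewrite ?inE.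
rewrite inE /= => ab e.
have : x \in [set a; b] by rewrite -e set21.
have : y \in [set a; b] by rewrite -e set22.
have : a \in [set x; y] by rewrite e set21.
have : b \in [set x; y] by rewrite e set22.
rewrite !inE => bx ax /orP[]/eqP yE /orP[]/eqP xE; move: bx ax ab.
- by rewrite xE yE !orbb => /eqP ->; rewrite adj_irrefl.
- by rewrite xE yE adj_sym.
- by rewrite xE yE.
- by rewrite xE yE !orbb => _ /eqP ->; rewrite adj_irrefl.
Qed.

Lemma sub_adj_adj (G : sgraph) (S : subgraph G) (x y : graph_of_subgraph S) :
  adj x y -> adj (val x) (val y).
Proof.
case/andP: (valP S) => /subsetP SE _ /SE.
by rewrite mem_edges.
Qed.

(** The centre of the star if the subgraph contains it; otherwise connectivity
    leaves room for a single leaf, since every edge contains the centre. *)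
Lemma star_sub_hub t (K : subgraph (star t)) :
  connected (graph_of_subgraph K) ->
  exists c : graph_of_subgraph K, forall v, v != c -> adj c v.
Proof.
case=> /card_gt0P[z _] conn.
have step (v c : graph_of_subgraph K) : v != c ->
    exists2 w : graph_of_subgraph K, adj v w & star_adj (val v) (val w).
  move=> vc; case/connectP: (conn v c) => [[|w p] /= +]; first by move=> _ e;
    rewrite e eqxx in vc.
  by case/andP=> vw _ _; exists w => //; apply: (sub_adj_adj vw).
case: (boolP (ord0 \in sub_vertices K)) => [o|o].
  pose c : graph_of_subgraph K := exist _ ord0 o.
  exists c => v vc; have [w vw] := step v c vc.
  have -> : star_adj (val v) (val w) = (val w == ord0).
    have : val v != val c by rewrite val_eqE.
    by rewrite /star_adj /= => /negPf ->.
  by move/eqP=> w0; rewrite adj_sym; have <- : w = c by apply: val_inj.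
have ne (v : graph_of_subgraph K) : (val v == ord0) = false.
  by apply: contraNF o => /eqP <-; apply: valP.
exists z => v vz; have [w _] := step v _ vz.
by rewrite /star_adj !ne.
Qed.

Lemma card_sub_graph (G : sgraph) (S : subgraph G) :
  #|graph_of_subgraph S| = #|sub_vertices S|.
Proof. by rewrite /= card_sig; apply: eq_card. Qed.

Lemma substructure_star_like (G : sgraph) t (S : subgraph G)
    (K : subgraph (star t)) :
  connected (graph_of_subgraph K) ->
  isomorphic (graph_of_subgraph S) (graph_of_subgraph K) ->
  star_like (@adj G) (sub_vertices S) /\ #|sub_vertices S| <= t.+1.
Proof.
move=> /star_sub_hub[c hc] [f bf fE]; split.
  case: (bf) => g gK fK; apply/existsP; exists (val (g c)); apply/andP.
  split; first exact: valP.
  apply/forall_inP => v vS; case: eqVneq => //= vc.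
  apply: (@sub_adj_adj _ S (g c) (Sub v vS)); rewrite -fE fK; apply: hc.
  by apply: contra_neq vc => <-; rewrite gK.
rewrite -card_sub_graph (bij_eq_card bf) card_sub_graph -[t.+1]card_ord.
exact: max_card.
Qed.

Lemma connect_induced (G : sgraph) (X : {set G})
    (x y : induced (~: X)) :
  connect (avoid (@adj G) X) (val x) (val y) ->
  connect (@adj (induced (~: X))) x y.
Proof.
case/connectP=> p; elim: p x => [|z p IHp] x /=.
  by move=> _ /val_inj ->.
case/andP=> /and3P[xX zX xz] pp ly.
have zX' : z \in ~: X by rewrite inE.
apply: (@connect_trans _ _ (Sub z zX')); first exact: connect1.
exact: IHp.
Qed.

(** Fewer members leave a connected graph by [star_removal_connected], and
    they are too small to leave only one vertex by [few_stars_lt_dcell]. *)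
Lemma substructure_cut_ge m n t (F : {set subgraph (dcell m n)}) :
  2 <= n -> substructure_cut (star t) F ->
  ceil_div (n - 1) (1 + t) + m <= #|F|.
Proof.
move=> n2 [cut sub]; rewrite leqNgt; apply/negP => lt_F.
pose P := [set sub_vertices S | S in F].
have room : (#|P| - m) * (1 + t) < n - 1.
  rewrite -ltn_ceil_div //;
    have := leq_imset_card (@sub_vertices (dcell m n)) F.
  have : 0 < ceil_div (n - 1) (1 + t) by rewrite ltn_ceil_div //; lia.
  by rewrite -/P; lia.
have st S : S \in P -> star_like (@dcell_adj m n) S /\ #|S| <= 1 + t.
  by case/imsetP=> T TF ->; case: (sub T TF) => K [cK];
    apply: substructure_star_like cK.
have XE : \bigcup_(S in F) sub_vertices S = cover P.
  apply/setP=> v; apply/bigcupP/bigcupP => [[S SF vS]|[_ /imsetP[S SF ->] vS]].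
    by exists (sub_vertices S); rewrite ?imset_f.
  by exists S.
case: cut => [[x [y]]|].
  apply/negP; rewrite negbK; apply: connect_induced.
  have xX := valP x; have yX := valP y; rewrite inE in xX; rewrite inE in yX.
  move: (val x) (val y) xX yX; rewrite XE => u v uX vX.
  apply: (@star_removal_connected m n (1 + t)) => // S /st[] //.
rewrite /trivial_graph /= card_sig XE => one.
have := few_stars_lt_dcell room; rewrite -card_dcell -(cardsC (cover P)).
have -> : #|~: cover P| = 1 by rewrite -one; apply: eq_card.
rewrite ltn_add2r ltnNge => /negP; apply;
  apply: card_bigcup_leq => S /st[sS cS].
by rewrite leq_min cS star_like_card // ltnW.
Qed.

(** * Covering a neighbourhood by stars *)

Lemma set_between (T : finType) (A B : {set T}) k :
  A \subset B -> #|A| <= k <= #|B| ->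
  exists2 C : {set T}, A \subset C & (C \subset B) && (#|C| == k).
Proof.
move=> AB /andP[Ak kB]; pose s := take (k - #|A|) (enum (B :\: A)).
have sE x : x \in s -> (x \notin A) && (x \in B).
  by move/mem_take; rewrite mem_enum inE.
exists (A :|: [set x in s]); first exact: subsetUl.
apply/andP; split.
  by rewrite subUset AB; apply/subsetP=> x; rewrite inE => /sE/andP[].
rewrite cardsU disjoint_setI0 ?cards0 ?subn0; last first.
  by rewrite disjoint_sym disjoints_subset; apply/subsetP=> x;
    rewrite !inE => /sE/andP[].
rewrite cardsE (card_uniqP _) ?take_uniq ?enum_uniq // size_takel ?subnKC //.
by rewrite -cardE cardsDS // leq_sub2r.
Qed.

Lemma coverU1 (T : finType) (W : {set T}) P : cover (W |: P) = W :|: cover P.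
Proof.
apply/setP=> x; rewrite inE; apply/bigcupP/orP => [[V]|[xW|/bigcupP[V VP xV]]].
- by case/setU1P=> [->|VP] xV; [left | right; apply/bigcupP; exists V].
- by exists W; rewrite ?setU11.
- by exists V; rewrite ?setU1r.
Qed.

(** Blocks are nonempty because each has to provide a hub. *)
Lemma blocks_exist (T : finType) s q (A : {set T}) : 0 < s -> #|A| <= q * s ->
  exists P : {set {set T}}, [/\ #|P| <= q, cover P = A &
    forall W, W \in P -> W != set0 /\ #|W| <= s].
Proof.
move=> s0; elim: q A => [|q IHq] A.
  rewrite leqn0 cards_eq0 => /eqP ->; exists set0.
  by rewrite cards0 /cover big_set0; split=> // W; rewrite inE.
move=> Aq; case: (eqVneq A set0) => [->|A0].
  by exists set0; rewrite cards0 /cover big_set0; split=> // W; rewrite inE.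
have [|W _ /andP[WA /eqP Wc]] := @set_between _ set0 A (minn s #|A|)
  (sub0set _).
  by rewrite cards0 geq_minr.
have [|P [Pq Pc PW]] := IHq (A :\: W).
  by rewrite cardsDS // Wc; move: Aq; rewrite mulSn; move: (q * s); lia.
exists (W |: P); split.
- by rewrite cardsU1; case: (_ \notin _); lia.
- by rewrite coverU1 Pc setDE setUIr setUCr setIT; apply/setUidPr.
move=> V; rewrite !inE => /predU1P[->|/PW //].
by rewrite -card_gt0 Wc leq_min s0 card_gt0 geq_minl.
Qed.

(** The [n - 1] neighbours of [x] in its innermost clique are cut into [q]
    blocks, in which every vertex is a hub; each dimension adds the partner of
    [x], a block by itself. With [q] the ceiling of [(n - 1) / s] this is the
    announced value. *)
Lemma neighbourhood_blocks m n s q (x : dcell_vertex m n) :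
  0 < s -> n - 1 <= q * s ->
  exists P : {set {set dcell_vertex m n}}, [/\ #|P| <= q + m,
    cover P = [set y | dcell_adj x y] &
    forall W, W \in P -> star_like (@dcell_adj m n) W /\ #|W| <= s].
Proof.
move=> s0 qs; elim: m x => [|m IHm] x.
  have [|P [Pq Pc PW]] := @blocks_exist _ s q [set y | dcell_adj x y] s0.
    rewrite card_neighbours //; move: (ltn_ord x); lia.
  exists P; split=> //; first by rewrite addn0.
  move=> W /PW[/set0Pn[c cW] ?]; split=> //; apply/existsP; exists c.
  by apply/andP; split=> //; apply/forall_inP => v vW; rewrite /= eq_sym;
    case: eqP.
rewrite [x]in_copyE; move: x.1 x.2 => i z {x}.
have [P [Pq Pc PW]] := IHm z; have [j ij [y a]] := cross_neighbour i z.
exists ([set in_copy j y]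
  |: [set in_copy i @: W | W : {set dcell_vertex m n} in P]).
split.
- rewrite cardsU1 addnS.
  by apply: (@leq_add _ _ 1);
    [exact: leq_b1 | exact: leq_trans (leq_imset_card _ _) Pq].
- rewrite coverU1 (neighbours_in_copy ij a) -Pc /cover; congr (_ |: _).
  apply/setP=> w;
    apply/bigcupP/imsetP => [[_ /imsetP[V VP ->] /imsetP[v vV ->]]|].
    by exists v => //; apply/bigcupP; exists V.
  case=> v /bigcupP[V VP vV] ->; exists (in_copy i @: V); exact: imset_f.
move=> W; rewrite in_setU1 => /orP[/eqP ->|].
  rewrite cards1; split=> //; apply/existsP; exists (in_copy j y).
  by apply/andP; split; rewrite ?set11 //; apply/forall_inP => v /set1P ->;
    rewrite eqxx.
case/imsetP=> V /PW[/existsP[c hc] Vs] ->.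
rewrite card_imset; last exact: in_copy_inj.
split=> //; apply/existsP; exists (in_copy i c); apply/andP; split.
  by apply: imset_f; apply: is_hub_mem hc.
apply/forall_inP => _ /imsetP[v vV ->]; rewrite dcell_adj_in.
by case: (eqVneq v c) => [->|vc]; rewrite ?eqxx // (is_hub_adj hc vV vc) orbT.
Qed.

(** * The isolating structure cut *)

Lemma isomorphic_sym (G H : sgraph) : isomorphic G H -> isomorphic H G.
Proof.
case=> f [g fK gK] fE; exists g; first by exists f.
by move=> x y; rewrite -fE !gK.
Qed.

Lemma isomorphic_trans (G H K : sgraph) :
  isomorphic G H -> isomorphic H K -> isomorphic G K.
Proof.
case=> f bf fE [g bg gE]; exists (g \o f); first exact: bij_comp.
by move=> x y /=; rewrite gE fE.
Qed.

Lemma isomorphic_connected (G H : sgraph) :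
  isomorphic G H -> connected G -> connected H.
Proof.
case=> f bf fE [G0 cG]; split; first by rewrite -(bij_eq_card bf).
case: bf => g gK fK x y; rewrite -(fK x) -(fK y).
by apply: connect_homo (cG _ _) => u v; rewrite fE.
Qed.

Lemma full_subgraph (G : sgraph) :
  exists S : subgraph G, isomorphic G (graph_of_subgraph S).
Proof.
have S_ok : is_subgraph ([set: G], edges G).
  by apply/andP; split=> //=; apply/forall_inP => e _; apply: subsetT.
pose S : subgraph G := exist (@is_subgraph G) _ S_ok.
have inS (x : G) : x \in sub_vertices S by rewrite inE.
pose f (x : G) : graph_of_subgraph S := exist _ x (inS x).
exists S, f; last by move=> x y; apply: mem_edges.
by exists val => // x; apply: val_inj.
Qed.

Lemma structure_substructure_cut (G H : sgraph) (F : {set subgraph G}) :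
  connected H -> structure_cut H F -> substructure_cut H F.
Proof.
move=> cH [cut iso]; split=> // S /iso SH.
have [K HK] := full_subgraph H; exists K; split.
  exact: isomorphic_connected cH.
exact: isomorphic_trans HK.
Qed.

Lemma star_connected t : connected (star t).
Proof.
split; first by rewrite card_ord.
have c0 (x : star t) : connect (@adj (star t)) ord0 x.
  by case: (eqVneq x ord0) => [->//|x0]; apply: connect1;
    rewrite /= /star_adj (negPf x0).
move=> x y; apply: connect_trans (c0 y).
by rewrite sym_connect_sym //; apply: adj_sym.
Qed.

(** The isomorphism is built from the star, whose leaf [lift ord0 j] goes to
    the [j]-th element of [L]. *)
Lemma star_subgraph (G : sgraph) (c : G) (L : {set G}) :
  L \subset [set v | adj c v] ->
  exists S : subgraph G, sub_vertices S = c |: L /\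
    isomorphic (graph_of_subgraph S) (star #|L|).
Proof.
move=> Lc; have Ladj v : v \in L -> adj c v by move/(subsetP Lc); rewrite inE.
have cL : c \notin L by apply/negP => /Ladj; rewrite adj_irrefl.
have S_ok : is_subgraph (c |: L, [set [set c; v] | v in L]).
  apply/andP; split=> /=.
    by apply/subsetP=> _ /imsetP[v /Ladj cv ->]; rewrite mem_edges.
  apply/forall_inP => _ /imsetP[v vL ->].
  by apply/subsetP=> w; rewrite !inE => /orP[->//|/eqP ->]; rewrite vL orbT.
pose S : subgraph G := exist (@is_subgraph G) _ S_ok; exists S; split=> //.
apply: isomorphic_sym.
pose f0 (i : star #|L|) : G :=
  if unlift ord0 i is Some j then enum_val j else c.
have f0S i : f0 i \in sub_vertices S.
  rewrite /f0; case: unlift => [j|]; last exact: setU11.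
  by rewrite setU1r // enum_valP.
pose f i : graph_of_subgraph S := exist _ (f0 i) (f0S i).
have f0_0 : f0 ord0 = c by rewrite /f0 unlift_none.
have f0_l j : f0 (lift ord0 j) = enum_val j by rewrite /f0 liftK.
have f0_in j : f0 (lift ord0 j) \in L by rewrite f0_l; apply: enum_valP.
have f_inj : injective f.
  move=> i k /(congr1 val) /=.
  case: (unliftP ord0 i) => [i'|] ->; case: (unliftP ord0 k) => [k'|] -> //.
  - by rewrite !f0_l => /enum_val_inj ->.
  - by rewrite f0_0 => e; have := f0_in i'; rewrite e (negPf cL).
  - by rewrite f0_0 => e; have := f0_in k'; rewrite -e (negPf cL).
exists f.
  apply: inj_card_bij => //; rewrite card_sub_graph card_ord.
  by rewrite /sub_vertices /= cardsU1 cL.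
have edgeL x y : y \in L ->
    ([set x; y] \in [set [set c; v] | v in L]) = (x == c).
  move=> yL; apply/imsetP/eqP => [[v vL e]|->]; last by exists y.
  have : c \in [set x; y] by rewrite e set21.
  by rewrite !inE => /orP[/eqP //|/eqP cy]; rewrite cy yL in cL.
move=> i k; rewrite /= /sub_adj /sub_edges /= /star_adj.
case: (unliftP ord0 k) => [k'|] ->.
  rewrite edgeL //; case: (unliftP ord0 i) => [i'|] ->;
    last by rewrite f0_0 eqxx.
  by rewrite /=; apply/eqP => e; have := f0_in i'; rewrite e (negPf cL).
rewrite f0_0 eqxx; case: (unliftP ord0 i) => [i'|] ->.
  by rewrite setUC edgeL // eqxx.
rewrite f0_0 eqxx; apply/imsetP => -[v vL e].
have : v \in [set c; c] by rewrite e set22.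
by rewrite !inE orbb => /eqP vc; rewrite -vc vL in cL.
Qed.

(** The hub [c] is adjacent to [x], so [m + n - 2 >= t] of its neighbours
    differ from [x]: enough to complete the block to a star with exactly [t]
    leaves that still avoids [x]. *)
Lemma block_star m n t (x : dcell m n) (W : {set dcell m n}) : 2 <= n ->
  t <= m + n - 2 -> star_like (@dcell_adj m n) W -> #|W| <= 1 + t ->
  W \subset [set y | dcell_adj x y] ->
  exists S : subgraph (dcell m n), [/\ W \subset sub_vertices S,
    x \notin sub_vertices S & isomorphic (graph_of_subgraph S) (star t)].
Proof.
move=> n2 tmn /existsP[c hc] Wt Wx; have cW := is_hub_mem hc.
have xc : dcell_adj x c by have := subsetP Wx _ cW; rewrite inE.
have xW v : v \in W -> v != x.
  by apply: contraTneq => ->; apply/negP => /(subsetP Wx);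
    rewrite inE dcell_adj_irrefl.
pose M := [set v | dcell_adj c v] :\ x.
have [||L WL /andP[LM /eqP Lt]] := @set_between _ (W :\ c) M t.
- apply/subsetP=> v; rewrite !inE => /andP[vc vW].
  by rewrite xW // (is_hub_adj hc vW vc).
- have cW' := cardsD1 c W; rewrite cW add1n in cW'.
  have cM := cardsD1 x [set v | dcell_adj c v].
  rewrite card_neighbours ?(ltnW n2) // inE dcell_adj_sym xc add1n in cM.
  rewrite -ltnS -cW' Wt -ltnS -cM.
  by move: tmn n2; clear; lia.
have [|S [SV Siso]] := @star_subgraph (dcell m n) c L.
  by apply: subset_trans LM _; apply: subD1set.
exists S; rewrite SV -Lt; split=> //.
  by rewrite -(setD1K cW); apply: setUS.
rewrite !inE negb_or eq_sym xW //=; apply/negP => /(subsetP LM).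
by rewrite !inE eqxx.
Qed.

(** The vertex [x] survives and is isolated: the rest is disconnected, or
    reduced to [x]. *)
Lemma isolating_cut (G : sgraph) (x : G) (F : {set subgraph G}) :
  x \notin \bigcup_(S in F) sub_vertices S ->
  [set y | adj x y] \subset \bigcup_(S in F) sub_vertices S -> subgraph_cut F.
Proof.
move=> xF NF; have xF' : x \in ~: \bigcup_(S in F) sub_vertices S.
  by rewrite inE.
pose u : remove_subgraphs F := exist _ x xF'.
case: (pickP [pred v : remove_subgraphs F | v != u]) => [v /= vu|none].
  left; exists u, v; apply/negP => /connectP[[|w p] /=].
    by move=> _ e; rewrite e eqxx in vu.
  case/andP=> uw _ _; have := valP w; rewrite inE => /negP; apply.
  by apply: (subsetP NF); rewrite inE.
right; rewrite /trivial_graph -(cards1 u) -cardsT; apply: eq_card => v.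
by rewrite !inE; have /negbFE -> := none v.
Qed.

Lemma structure_cut_exists m n t : 2 <= n -> t <= m + n - 2 ->
  exists2 F : {set subgraph (dcell m n)}, structure_cut (star t) F &
    #|F| <= ceil_div (n - 1) (1 + t) + m.
Proof.
move=> n2 tmn; have n0 : 0 < n by apply: ltnW.
have /card_gt0P[x _] : 0 < #|dcell_vertex m n|.
  by rewrite card_dcell; apply: leq_trans (dcell_t_ge m n0);
    rewrite addn_gt0 n0 orbT.
have [|P [Pq Pc PW]] :=
  @neighbourhood_blocks m n (1 + t) (ceil_div (n - 1) (1 + t)) x isT.
  by rewrite leqNgt -ltn_ceil_div // ltnn.
have /fin_all_exists[f fP] (W : {set dcell m n}) :
    exists S : subgraph (dcell m n),
    W \in P -> [/\ W \subset sub_vertices S,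
    x \notin sub_vertices S & isomorphic (graph_of_subgraph S) (star t)].
  case: (boolP (W \in P)) => [WP|_]; last first.
    by have [S _] := full_subgraph (dcell m n); exists S.
  have [sW cW] := PW _ WP.
  have [|S ?] := @block_star m n t x W n2 tmn sW cW; last by exists S.
  by rewrite -Pc; apply: bigcup_sup.
exists (f @: P); last exact: leq_trans (leq_imset_card _ _) Pq.
split; last by move=> _ /imsetP[W /fP[_ _ ?] ->].
apply: (@isolating_cut (dcell m n) x).
  by apply/bigcupP => -[_ /imsetP[W /fP[_ /negP xW _] ->]].
apply/subsetP=> y; rewrite inE => xy.
have : y \in cover P by rewrite Pc inE.
case/bigcupP=> W WP yW; apply/bigcupP; exists (f W); first exact: imset_f.
by have [/subsetP WS _ _] := fP _ WP; apply: WS.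
Qed.

Theorem theorem3p5 (m n t : nat) (hn : 2 <= n) (ht : 1 <= t <= m + n - 2) :
  structure_connectivity_is (dcell m n) (star t)
    (ceil_div (n - 1) (1 + t) + m) /\
  substructure_connectivity_is (dcell m n) (star t)
    (ceil_div (n - 1) (1 + t) + m).
Proof.
case/andP: ht => _ ht; have [F Fcut Fk] := structure_cut_exists hn ht.
have Fsub := structure_substructure_cut (star_connected t) Fcut.
have Fk' : #|F| = ceil_div (n - 1) (1 + t) + m.
  by apply/eqP; rewrite eqn_leq Fk; apply: substructure_cut_ge Fsub.
split; split; try by exists F.
  by move=> F' /(structure_substructure_cut (star_connected t));
    apply: substructure_cut_ge.
by move=> F'; apply: substructure_cut_ge.
Qed.
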